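(* Let $w_1,w_2,w_3$ be any odd positive integers, let $n\ge 0$ be an integer and let $y_1\in\mathbb{Z}_p$. Then \begin{align*} &\sum_{k+l+m=n}\binom{n}{k,l,m}E_{k,q^{w_2w_3}}(w_1y_1)T_{l,q^{w_1w_3}}(w_2-1)T_{m,q^{w_1w_2}}(w_3-1)\,w_1^{l+m}w_2^{k+m}w_3^{k+l}\\ =&\sum_{k+l+m=n}\binom{n}{k,l,m}E_{k,q^{w_1w_3}}(w_2y_1)T_{l,q^{w_1w_2}}(w_3-1)T_{m,q^{w_2w_3}}(w_1-1)\,w_2^{l+m}w_3^{k+m}w_1^{k+l}\\ =&\sum_{k+l+m=n}\binom{n}{k,l,m}E_{k,q^{w_1w_2}}(w_3y_1)T_{l,q^{w_2w_3}}(w_1-1)T_{m,q^{w_1w_3}}(w_2-1)\,w_3^{l+m}w_1^{k+m}w_2^{k+l}. \end{align*}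
   Context: Let $p$ be a fixed odd prime, $\mathbb{C}_p$ the completion of an algebraic closure of $\mathbb{Q}_p$ with absolute value normalized by $|p|_p=1/p$, and let $q\in\mathbb{C}_p$ be fixed with $|q-1|_p<p^{-1/(p-1)}$. For $r\in\mathbb{C}_p$ with $|r-1|_p<p^{-1/(p-1)}$ (in particular for $r=q^w$, $w$ a positive integer), the $r$-Euler polynomials $E_{n,r}(x)$ ($n\ge 0$) are the polynomials in $x$ defined by the generating function $$\frac{2}{re^{t}+1}e^{xt}=\sum_{n=0}^{\infty}E_{n,r}(x)\frac{t^n}{n!}.$$ For integers $k,N\ge 0$, the $r$-analogue of the alternating power sum is $T_{k,r}(N)=\sum_{i=0}^{N}(-1)^i i^k r^i$, with the convention $0^0=1$. Sums over $k+l+m=n$ run over all nonnegative integers $k,l,m$ with $k+l+m=n$, and $\binom{n}{k,l,m}=\frac{n!}{k!\,l!\,m!}$. *)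

(* Defs.v *)
From HB Require Import structures.
From mathcomp Require Import all_boot all_order all_algebra.
From mathcomp Require Import reals exp.

Set Implicit Arguments.
Unset Strict Implicit.
Unset Printing Implicit Defensive.

Import Order.TTheory GRing.Theory Num.Theory.

Local Open Scope ring_scope.

Record nonarch_absval (R : realType) (F : fieldType) (v : F -> R) : Prop :=
  NonarchAbsval {
    absval_ge0 : forall x, 0 <= v x;
    absval_eq0 : forall x, v x = 0 <-> x = 0;
    absvalM : forall x y, v (x * y) = v x * v y;
    absvalD : forall x y, v (x + y) <= Num.max (v x) (v y)
  }.

Definition absval_cauchy (R : realType) (F : fieldType) (v : F -> R)
    (u : nat -> F) : Prop :=
  forall e : R, 0 < e ->
    exists N : nat, forall m n : nat,
      (N <= m)%N -> (N <= n)%N -> v (u m - u n) < e.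

Definition absval_cvg (R : realType) (F : fieldType) (v : F -> R)
    (u : nat -> F) (l : F) : Prop :=
  forall e : R, 0 < e ->
    exists N : nat, forall n : nat, (N <= n)%N -> v (u n - l) < e.

Record is_completion (R : realType) (F : fieldType) (vF : F -> R)
    (K : fieldType) (vK : K -> R) (j : {rmorphism F -> K}) : Prop :=
  IsCompletion {
    completion_absval : nonarch_absval vK;
    completion_isometry : forall x, vK (j x) = vF x;
    completion_dense : forall (y : K) (e : R), 0 < e ->
      exists x : F, vK (y - j x) < e;
    completion_complete : forall u : nat -> K,
      absval_cauchy vK u -> exists l : K, absval_cvg vK u l
  }.

Record is_algebraic_closure (F L : fieldType) (i : {rmorphism F -> L}) : Prop :=
  IsAlgebraicClosure {
    algebraic_closure_closed : GRing.closed_field_axiom L;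
    algebraic_closure_algebraic : forall x : L, algebraicOver i x
  }.

(* |x|_p = p ^ (v_p (denominator) - v_p (numerator)), so that |p|_p = 1 / p. *)
Definition padic_abs (R : realType) (p : nat) (x : rat) : R :=
  if x == 0 then 0
  else p%:R ^+ logn p `|denq x|%N / p%:R ^+ logn p `|numq x|%N.

(* A tower Q -> Q_p -> Q_p^alg -> C_p: a completion Q_p of Q for |.|_p, an
   algebraic closure of Q_p with an absolute value extending that of Q_p, and a
   completion C_p of the latter. Such a tower is unique up to isometric
   isomorphism; C_p is specified here by these properties and is not
   constructed. *)
Record padic_complex (R : realType) (p : nat) := PadicComplex {
  Qp : fieldType;
  abs_Qp : Qp -> R;
  rat_to_Qp : {rmorphism rat -> Qp};
  Qp_completion : is_completion (padic_abs R p) abs_Qp rat_to_Qp;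

  Qpalg : fieldType;
  abs_Qpalg : Qpalg -> R;
  Qp_to_Qpalg : {rmorphism Qp -> Qpalg};
  Qpalg_closure : is_algebraic_closure Qp_to_Qpalg;
  Qpalg_absval : nonarch_absval abs_Qpalg;
  Qpalg_extends : forall x : Qp, abs_Qpalg (Qp_to_Qpalg x) = abs_Qp x;

  Cp : fieldType;
  abs_Cp : Cp -> R;
  Qpalg_to_Cp : {rmorphism Qpalg -> Cp};
  Cp_completion : is_completion abs_Qpalg abs_Cp Qpalg_to_Cp
}.

Definition Qp_to_Cp (R : realType) (p : nat) (C : padic_complex R p)
  (x : Qp C) : Cp C := Qpalg_to_Cp C (Qp_to_Qpalg C x).

Definition in_Zp (R : realType) (p : nat) (C : padic_complex R p)
  (x : Qp C) : Prop := abs_Qp x <= 1.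

(* A formal power series in t is its sequence of coefficients. *)

Definition fps_mul (A : comUnitRingType) (f g : nat -> A) : nat -> A :=
  fun n => \sum_(i < n.+1) f i * g (n - i)%N.

(* fps_inv_seq f n = [:: g_n; ...; g_0], where g is the inverse of f. *)
Fixpoint fps_inv_seq (A : comUnitRingType) (f : nat -> A) (n : nat) : seq A :=
  if n is n'.+1 then
    let s := fps_inv_seq f n' in
    (- (f 0%N)^-1 * \sum_(i < n'.+1) f i.+1 * s`_i) :: s
  else [:: (f 0%N)^-1].

(* Meaningful only when f 0 is a unit. *)
Definition fps_inv (A : comUnitRingType) (f : nat -> A) : nat -> A :=
  fun n => (fps_inv_seq f n)`_0.

Lemma fps_inv_seqE (A : comUnitRingType) (f : nat -> A) (n i : nat) :
  (i <= n)%N -> (fps_inv_seq f n)`_i = fps_inv f (n - i)%N.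
Proof.
elim: n i => [|n IHn] [|i] //= le_in.
by rewrite IHn // subSS.
Qed.

Lemma fps_mulV (A : comUnitRingType) (f : nat -> A) (n : nat) :
  f 0%N \is a GRing.unit -> fps_mul f (fps_inv f) n = (n == 0%N)%:R.
Proof.
move=> Uf; rewrite /fps_mul; case: n => [|n].
  by rewrite big_ord_recl big_ord0 addr0 subnn /fps_inv /= divrr.
rewrite big_ord_recl subn0 {1}/fps_inv /= mulNr mulrN mulrA divrr // mul1r.
rewrite addrC; apply/eqP; rewrite subr_eq0; apply/eqP; apply: eq_bigr => i _.
by rewrite fps_inv_seqE ?subSS // -ltnS.
Qed.

(* e ^ (c t), with coefficients in K[x]. *)
Definition fps_exp (K : fieldType) (c : {poly K}) : nat -> {poly K} :=
  fun n => (n`!%:R)^-1 *: c ^+ n.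

(* The series 2 / (r e^t + 1) * e^(x t) in K[x][[t]]. *)
Definition euler_series (K : fieldType) (r : K) : nat -> {poly K} :=
  fps_mul
    (fun n => 2 *: fps_inv (fun k => r *: fps_exp 1 k + (k == 0%N)%:R) n)
    (fps_exp 'X).

Definition euler_poly (K : fieldType) (r : K) (n : nat) : {poly K} :=
  n`!%:R *: euler_series r n.

Definition alt_power_sum (K : fieldType) (r : K) (k N : nat) : K :=
  \sum_(i < N.+1) (-1) ^+ i * i%:R ^+ k * r ^+ i.

Definition trinomial (n k l m : nat) : nat :=
  (n`! %/ (k`! * l`! * m`!))%N.

(* The sum of F k l m over all k, l, m with k + l + m = n. *)
Definition sum_triples (V : nmodType) (n : nat) (F : nat -> nat -> nat -> V) : V :=
  \sum_(k < n.+1) \sum_(l < n.+1) \sum_(m < n.+1 | (k + l + m)%N == n) F k l m.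

(* Main.v *)
Require Import Defs.
From mathcomp Require Import all_boot all_order all_algebra.
From mathcomp Require Import boolp reals exp.
From mathcomp Require Import ring.

Import Order.TTheory GRing.Theory Num.Theory.
Local Open Scope ring_scope.

(* Put W = w1 w2 w3, D = q^W e^(W t) + 1 and A_j = q^(W/w_j) e^((W/w_j) t) + 1.
   The first sum is n! times the coefficient of t^n in E_1 T_2 T_3, where
   E_1 A_1 = 2 e^(W y t) and, as a geometric sum with an odd number of terms,
   T_j A_j = D. Hence A_1 A_2 (E_1 T_2 T_3) = 2 e^(W y t) D T_3
   = A_1 A_2 (E_2 T_3 T_1), and the A_j are invertible since their constant
   terms q^(W/w_j) + 1 are congruent to 2, a p-adic unit. The other equality is
   the same one with the w_j permuted cyclically. *)

(** * Ring laws, cancellation and rescaling for formal power series *)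

Section FormalPowerSeries.
Variable A : comUnitRingType.
Implicit Types f g h : nat -> A.

(** Truncating both factors above degree n leaves the coefficient of t^n unchanged, so the ring laws
    of series follow from those of polynomials. *)
Lemma fps_mul_coef (N n : nat) f g : (n < N)%N ->
  fps_mul f g n = ((\poly_(i < N) f i) * (\poly_(i < N) g i))`_n.
Proof.
move=> ltnN; rewrite coefM; apply: eq_bigr => i _.
rewrite !coef_poly (leq_ltn_trans (leq_ord i) ltnN).
by rewrite (leq_ltn_trans (leq_subr i n) ltnN).
Qed.

Lemma fps_mulC f g : fps_mul f g = fps_mul g f.
Proof.
by apply: funext => n; rewrite !(@fps_mul_coef n.+1) // mulrC.
Qed.

Lemma coef_poly_fps_mul (N : nat) f g n : (n < N)%N ->
  (\poly_(i < N) fps_mul f g i)`_n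
  = ((\poly_(i < N) f i) * (\poly_(i < N) g i))`_n.
Proof. by move=> ltnN; rewrite coef_poly ltnN; exact: fps_mul_coef. Qed.

Lemma fps_mulA f g h : fps_mul f (fps_mul g h) = fps_mul (fps_mul f g) h.
Proof.
apply: funext => n; rewrite !(@fps_mul_coef n.+1) //.
set P := \poly_(i < n.+1) f i; set Q := \poly_(i < n.+1) h i.
(* Only coefficients up to n of an inner product enter, and there it agrees with the product of the
   truncations. *)
transitivity ((P * (\poly_(i < n.+1) g i) * Q)`_n).
  rewrite -mulrA 2!coefM; apply: eq_bigr => i _.
  by rewrite coef_poly_fps_mul // ltnS leq_subr.
rewrite 2!coefM; apply: eq_bigr => i _.
by rewrite coef_poly_fps_mul.
Qed.

Lemma fps_mulAC f g h : fps_mul (fps_mul f g) h = fps_mul (fps_mul f h) g.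
Proof. by rewrite -!fps_mulA (fps_mulC g). Qed.

Lemma fps_mul1 f : fps_mul f (fun n => (n == 0%N)%:R) = f.
Proof.
apply: funext => n; rewrite /fps_mul big_ord_recr /= subnn eqxx mulr1.
rewrite big1 ?add0r // => i _.
by rewrite subn_eq0 leqNgt ltn_ord mulr0.
Qed.

Lemma fps_mulIf a f g : a 0%N \is a GRing.unit ->
  fps_mul f a = fps_mul g a -> f = g.
Proof.
move=> Ua fa_ga.
have aV : fps_mul a (fps_inv a) = (fun n => (n == 0%N)%:R).
  by apply: funext => n; exact: fps_mulV.
by rewrite -(fps_mul1 f) -(fps_mul1 g) -aV !fps_mulA fa_ga.
Qed.

(** Substitution of c t for t. *)
Definition fps_scale (c : A) f : nat -> A := fun n => c ^+ n * f n.

Lemma fps_mul_scale c f g :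
  fps_mul (fps_scale c f) (fps_scale c g) = fps_scale c (fps_mul f g).
Proof.
apply: funext => n; rewrite /fps_scale /fps_mul mulr_sumr.
apply: eq_bigr => i _; rewrite mulrACA -exprD subnKC //.
exact: leq_ord.
Qed.

(** For fixed k and l, the only admissible m is n - k - l when k + l <= n, and there is none
    otherwise. *)
Lemma sum_triples_fps_mul n f g h :
  sum_triples n (fun k l m => f k * (g l * h m)) = fps_mul f (fps_mul g h) n.
Proof.
rewrite /sum_triples /fps_mul; apply: eq_bigr => k _.
have lekn := leq_ord k.
rewrite mulr_sumr.
rewrite (big_ord_widen_cond n.+1 predT
  (fun l => f k * (g l * h (n - k - l)%N))) ?ltnS ?leq_subr //.
rewrite [RHS]big_mkcond; apply: eq_bigr => l _ /=.
rewrite ltnS leq_subRL //; case: leqP => [le_kl_n|lt_n_kl].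
  have ltm : (n - k - l < n.+1)%N by rewrite ltnS -subnDA leq_subr.
  rewrite (big_pred1 (Ordinal ltm)) // => m; rewrite /= -val_eqE /=.
  by rewrite -subnDA -(eqn_add2l (k + l)%N m) subnKC.
rewrite big1 // => m /eqP def_n; move: lt_n_kl.
by rewrite -{1}def_n ltnNge leq_addr.
Qed.

End FormalPowerSeries.

(** * Sums over triples and trinomial coefficients *)

Lemma eq_sum_triples (V : nmodType) n (F G : nat -> nat -> nat -> V) :
  (forall k l m, (k + l + m)%N = n -> F k l m = G k l m) ->
  sum_triples n F = sum_triples n G.
Proof.
move=> eqFG; do 2![apply: eq_bigr => ? _].
by apply: eq_bigr => m /eqP; exact: eqFG.
Qed.

Lemma mulr_sum_triples (A : pzRingType) (a : A) n (F : nat -> nat -> nat -> A) :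
  a * sum_triples n F = sum_triples n (fun k l m => a * F k l m).
Proof.
rewrite /sum_triples mulr_sumr; apply: eq_bigr => k _.
by rewrite mulr_sumr; apply: eq_bigr => l _; rewrite mulr_sumr.
Qed.

(** The integer division is exact: its value is the product of two binomial coefficients. *)
Lemma trinomialM n k l m : (k + l + m)%N = n ->
  (trinomial n k l m * (k`! * l`! * m`!))%N = n`!.
Proof.
move=> <-; rewrite /trinomial divnK //.
apply/dvdnP; exists ('C(k + l + m, k + l) * 'C(k + l, k))%N.
rewrite -(bin_fact (leq_addr m (k + l))) -(bin_fact (leq_addr l k)) !addKn.
by rewrite !mulnA.
Qed.

(** * Generating functions over a field of characteristic zero *)

Section EulerSeries.
Variable K : fieldType.
Hypothesis natf_neq0 : forall n, n.+1%:R != 0 :> K.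
Implicit Types a b c r x : K.

Let fact_neq0 n : n`!%:R != 0 :> K.
Proof. by case: n`! (fact_gt0 n) => // m _; exact: natf_neq0. Qed.

Definition exp_fps c : nat -> K := fun n => c ^+ n / n`!%:R.

Lemma exp_fps0 n : exp_fps 0 n = (n == 0%N)%:R.
Proof. rewrite /exp_fps; case: n => [|n]; first by rewrite divr1 expr0.
by rewrite exprS !mul0r. Qed.

Lemma exp_fpsD a b : fps_mul (exp_fps a) (exp_fps b) = exp_fps (a + b).
Proof.
apply: funext => n; rewrite /fps_mul /exp_fps addrC exprDn mulr_suml.
apply: eq_bigr => i _; rewrite -mulr_natr.
rewrite -(bin_fact (leq_ord i)) !natrM; field.
(* It remains that the binomial coefficient is nonzero in K, which holds since it is a factor of
   n!. *)
rewrite !fact_neq0 /=; have := fact_neq0 n.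
by rewrite -(bin_fact (leq_ord i)) !natrM !mulf_eq0 !negb_or => /andP[].
Qed.

Definition exp_add1 r c : nat -> K := fun n => r * exp_fps c n + (n == 0%N)%:R.

(** The sum of (- r e^(c t))^i over 0 <= i <= N, expanded in powers of t. *)
Definition alt_power_fps r c N : nat -> K :=
  fun l => c ^+ l * alt_power_sum r l N / l`!%:R.

Lemma sum_alt_telescope (V : comPzRingType) (g : nat -> V) w : odd w ->
  \sum_(i < w) (-1) ^+ i * (g i.+1 + g i) = g w + g 0%N.
Proof.
have tel n : \sum_(i < n) (-1) ^+ i * (g i.+1 + g i) = g 0%N - (-1) ^+ n * g n.
  elim: n => [|n IHn]; first by rewrite big_ord0 expr0; ring.
  by rewrite big_ord_recr /= IHn exprS; ring.
by move=> oddw; rewrite tel -signr_odd oddw expr1; ring.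
Qed.

(** A geometric sum of ratio - r e^(c t): multiplied by 1 + r e^(c t) it telescopes, and the last
    term has sign + because w is odd. *)
Lemma alt_power_fps_mul r c w : odd w ->
  fps_mul (alt_power_fps r c (w - 1)) (exp_add1 r c)
  = exp_add1 (r ^+ w) (w%:R * c).
Proof.
move=> oddw; apply: funext => n.
(* [g i] is the coefficient of t^n in (r e^(c t))^i. *)
pose g i := r ^+ i * exp_fps (i%:R * c) n.
transitivity (\sum_(i < w) (-1) ^+ i * (g i.+1 + g i)); last first.
  by rewrite sum_alt_telescope // /g mul0r exp_fps0 expr0 mul1r.
have E0 i : fps_mul (exp_fps (i%:R * c)) (exp_add1 r c) n
            = r * exp_fps (i.+1%:R * c) n + exp_fps (i%:R * c) n.
  rewrite -{2}(fps_mul1 _ (exp_fps (i%:R * c))) -natr1 mulrDl mul1r -exp_fpsD.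
  rewrite /fps_mul mulr_sumr -big_split; apply: eq_bigr => j _ /=.
  by rewrite /exp_add1; ring.
transitivity (\sum_(i < w) (-1) ^+ i * r ^+ i
   * fps_mul (exp_fps (i%:R * c)) (exp_add1 r c) n).
  rewrite /fps_mul; under [RHS]eq_bigr do rewrite mulr_sumr.
  rewrite exchange_big; apply: eq_bigr => j _ /=.
  (* The upper index w - 1 is inclusive, so there are w terms; w is positive because it is odd. *)
  rewrite /alt_power_fps /alt_power_sum subn1 prednK ?odd_gt0 //.
  rewrite mulr_sumr !mulr_suml; apply: eq_bigr => i _.
  by rewrite /exp_fps exprMn; ring.
by apply: eq_bigr => i _; rewrite E0 /g exprS; ring.
Qed.

(** Evaluation at x is a ring morphism on K[x], so it may be applied coefficientwise to the defining
    series. *)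
Lemma euler_series_mul r x : r + 1 != 0 ->
  fps_mul (fun k => (euler_series r k).[x]) (exp_add1 r 1)
  = (fun n => 2 * exp_fps x n).
Proof.
move=> r1_neq0.
pose B : nat -> {poly K} := fun k => r *: fps_exp 1 k + (k == 0%N)%:R.
have UB : B 0%N \is a GRing.unit.
  (* The constant term is a nonzero constant, hence a unit of K[x], which makes [fps_inv B] a true
     inverse. *)
  have -> : B 0%N = (r + 1)%:P.
    by rewrite /B /fps_exp expr0 invr1 scale1r -mul_polyC mulr1 polyCD.
  by rewrite rmorph_unit ?unitfE.
have BE k : (B k).[x] = exp_add1 r 1 k.
  rewrite /B /fps_exp /exp_add1 /exp_fps !expr1n.
  by rewrite hornerD !hornerZ -polyC_natr !hornerC mulr1 mul1r.
have VB : fps_mul (fun k => (fps_inv B k).[x]) (exp_add1 r 1)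
          = (fun n => (n == 0%N)%:R).
  apply: funext => n; rewrite fps_mulC.
  have := congr1 (horner^~ x) (fps_mulV n UB).
  rewrite -polyC_natr hornerC => <-.
  rewrite /fps_mul horner_sum; apply: eq_bigr => i _.
  by rewrite hornerM BE.
have -> : (fun k => (euler_series r k).[x])
    = fps_mul (fun n => 2 * exp_fps x n) (fun k => (fps_inv B k).[x]).
  rewrite fps_mulC; apply: funext => k.
  rewrite /euler_series /fps_mul horner_sum; apply: eq_bigr => i _.
  rewrite hornerM hornerZ /fps_exp /exp_fps hornerZ hornerXn -/B.
  by ring.
by rewrite -fps_mulA VB fps_mul1.
Qed.

(** For r + 1 nonzero, the series 2 e^(c x t) / (r e^(c t) + 1). *)
Definition euler_fps r c x := fps_scale K c (fun k => (euler_series r k).[x]).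

Lemma euler_fps_mul r c x : r + 1 != 0 ->
  fps_mul (euler_fps r c x) (exp_add1 r c) = (fun n => 2 * exp_fps (c * x) n).
Proof.
move=> r1_neq0.
have -> : exp_add1 r c = fps_scale K c (exp_add1 r 1).
  apply: funext => n; rewrite /exp_add1 /fps_scale /exp_fps expr1n.
  by case: n => [|n] /=; rewrite ?expr0; ring.
rewrite fps_mul_scale euler_series_mul //; apply: funext => n.
by rewrite /fps_scale /exp_fps exprMn; ring.
Qed.

Lemma exp_add1_unit r c : r + 1 != 0 -> exp_add1 r c 0%N \is a GRing.unit.
Proof. by rewrite unitfE /exp_add1 /exp_fps expr0 divr1 mulr1. Qed.

(** * The symmetric sum and its cyclic shift *)

Definition euler_power_sum (q y : K) n (w1 w2 w3 : nat) : K :=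
  sum_triples n (fun k l m =>
    (trinomial n k l m)%:R
    * (euler_poly (q ^+ (w2 * w3)) k).[w1%:R * y]
    * alt_power_sum (q ^+ (w1 * w3)) l (w2 - 1)
    * alt_power_sum (q ^+ (w1 * w2)) m (w3 - 1)
    * w1%:R ^+ (l + m) * w2%:R ^+ (k + m) * w3%:R ^+ (k + l)).

(** The weights regroup as (w2 w3)^k (w1 w3)^l (w1 w2)^m, which are the rescalings of t in the three
    series. *)
Lemma euler_power_sumE q y n w1 w2 w3 :
  euler_power_sum q y n w1 w2 w3 = n`!%:R *
    fps_mul (euler_fps (q ^+ (w2 * w3)) (w2 * w3)%:R (w1%:R * y))
      (fps_mul (alt_power_fps (q ^+ (w1 * w3)) (w1 * w3)%:R (w2 - 1))
               (alt_power_fps (q ^+ (w1 * w2)) (w1 * w2)%:R (w3 - 1))) n.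
Proof.
rewrite -sum_triples_fps_mul mulr_sum_triples.
apply: eq_sum_triples => k l m def_n.
rewrite -(trinomialM _ _ _ _ def_n) !natrM /euler_fps /alt_power_fps /fps_scale.
rewrite /euler_poly hornerZ !exprMn !exprD.
by field; rewrite !fact_neq0.
Qed.

Lemma euler_power_sum_cycle q y n w1 w2 w3 :
  (forall w, odd w -> q ^+ w + 1 != 0) -> odd w1 -> odd w2 -> odd w3 ->
  euler_power_sum q y n w1 w2 w3 = euler_power_sum q y n w2 w3 w1.
Proof.
move=> q1_neq0 o1 o2 o3; rewrite !euler_power_sumE; congr (_ * _).
rewrite (mulnC w3 w1) (mulnC w2 w1).
set E1 := euler_fps _ _ (w1%:R * y); set E2 := euler_fps _ _ (w2%:R * y).
set T1 := alt_power_fps _ _ (w1 - 1); set T2 := alt_power_fps _ _ (w2 - 1).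
set T3 := alt_power_fps _ _ (w3 - 1).
pose A1 := exp_add1 (q ^+ (w2 * w3)) (w2 * w3)%:R.
pose A2 := exp_add1 (q ^+ (w1 * w3)) (w1 * w3)%:R.
(* Both products are 2 e^(w1 w2 w3 y t). *)
have ET1 : fps_mul E1 A1 = fps_mul E2 A2.
  rewrite !euler_fps_mul ?q1_neq0 ?oddM ?o1 ?o2 ?o3 //.
  by apply: funext => i; congr (_ * exp_fps _ _); rewrite !natrM; ring.
(* With W = w1 w2 w3, both products are q^W e^(W t) + 1. *)
have ET2 : fps_mul T2 A2 = fps_mul T1 A1.
  rewrite !alt_power_fps_mul // -!exprM -!natrM.
  by congr (exp_add1 (q ^+ _) _%:R); ring.
have UA1 : A1 0%N \is a GRing.unit by rewrite exp_add1_unit // q1_neq0 ?oddM ?o2.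
have UA2 : A2 0%N \is a GRing.unit by rewrite exp_add1_unit // q1_neq0 ?oddM ?o1.
apply: (congr1 (fun f : nat -> K => f n)).
apply: (fps_mulIf _ A1 _ _ UA1); apply: (fps_mulIf _ A2 _ _ UA2).
have regroup (e t u a b : nat -> K) :
    fps_mul (fps_mul (fps_mul e (fps_mul t u)) a) b
    = fps_mul (fps_mul (fps_mul e a) (fps_mul t b)) u.
  rewrite fps_mulA (fps_mulAC _ _ u a) (fps_mulAC _ _ u b).
  by congr (fps_mul _ u); rewrite (fps_mulAC _ e t a) -fps_mulA.
(* Both sides become products of [E2], [T1], [T3], [A1] and [A2], differing only in order. *)
rewrite regroup ET1 ET2 (fps_mulC _ T3 T1) regroup; congr (fps_mul _ T3).
by rewrite !fps_mulA (fps_mulAC _ E2 A2) (fps_mulAC _ E2 A1) fps_mulAC.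
Qed.

End EulerSeries.

(** * Absolute values and principal units in C_p *)

Section PadicComplex.
Variables (R : realType) (p : nat) (C : padic_complex R p).

Let rat_to_Cp (x : rat) : Cp C := Qp_to_Cp (rat_to_Qp C x).

Let rat_to_Cp_int (m : int) : rat_to_Cp m%:~R = m%:~R.
Proof. by rewrite /rat_to_Cp /Qp_to_Cp !rmorph_int. Qed.

(** Characteristic zero passes from Q up the tower, field morphisms being injective. *)
Lemma Cp_natr_neq0 n : n.+1%:R != 0 :> Cp C.
Proof.
rewrite pmulrn -rat_to_Cp_int /rat_to_Cp /Qp_to_Cp !fmorph_eq0.
by rewrite intr_eq0.
Qed.

Lemma abs_Cp_int (m : int) : abs_Cp (m%:~R : Cp C) = padic_abs R p m%:~R.
Proof.
rewrite -rat_to_Cp_int /rat_to_Cp /Qp_to_Cp.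
rewrite (completion_isometry (Cp_completion C)) Qpalg_extends.
by rewrite (completion_isometry (Qp_completion C)).
Qed.

Hypotheses (p_prime : prime p) (p_odd : odd p).

Lemma abs_Cp_N2 : abs_Cp (- 2 : Cp C) = 1.
Proof.
have -> : - 2 = (- 2)%:~R :> Cp C by rewrite intrN.
rewrite abs_Cp_int /padic_abs intr_eq0 numq_int denq_int /= logn1.
(* The odd prime p does not divide 2. *)
by rewrite lognE p_prime /= dvdn_prime2 // gtn_eqF ?odd_prime_gt2 // expr0 divr1.
Qed.

(** The ultrametric inequality makes the open unit ball around 1 closed under multiplication. *)
Lemma principal_unit_exp (q : Cp C) n :
  abs_Cp (q - 1) < 1 -> abs_Cp (q ^+ n - 1) < 1.
Proof.
have [v0 v_eq0 vM vD] := completion_absval (Cp_completion C).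
move=> q1; elim: n => [|n IHn].
  by rewrite subrr (proj2 (v_eq0 0)).
have -> : q ^+ n.+1 - 1 = (q ^+ n - 1) * (q - 1) + ((q ^+ n - 1) + (q - 1)).
  by rewrite exprS; ring.
rewrite (le_lt_trans (vD _ _)) // gt_max vM mulr_ilt1 ?v0 //=.
by rewrite (le_lt_trans (vD _ _)) // gt_max IHn.
Qed.

(** If q^n were -1, then q^n - 1 = -2 would have absolute value 1. *)
Lemma principal_unit_exp_add1_neq0 (q : Cp C) n :
  abs_Cp (q - 1) < 1 -> q ^+ n + 1 != 0.
Proof.
move=> q1; apply/eqP => /eqP; rewrite addr_eq0 => /eqP qn.
have := principal_unit_exp q n q1.
by rewrite qn -opprD -(natrD _ 1 1) abs_Cp_N2 ltxx.
Qed.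

End PadicComplex.

Theorem theorem4p8 (R : realType) (p : nat) (p_prime : prime p) (p_odd : odd p)
  (C : padic_complex R p) (q : Cp C)
  (hq : abs_Cp (q - 1) < p%:R `^ (- (p%:R - 1)^-1))
  (w1 w2 w3 : nat) (hw1 : odd w1) (hw2 : odd w2) (hw3 : odd w3)
  (n : nat) (y1 : Qp C) (hy1 : in_Zp y1) :
  let E r k x := (euler_poly r k).[x] in
  let T k r N := alt_power_sum r k N in
  let y := Qp_to_Cp y1 in
  sum_triples n (fun k l m =>
    (trinomial n k l m)%:R
    * E (q ^+ (w2 * w3)) k (w1%:R * y)
    * T l (q ^+ (w1 * w3)) (w2 - 1)%N
    * T m (q ^+ (w1 * w2)) (w3 - 1)%N
    * w1%:R ^+ (l + m) * w2%:R ^+ (k + m) * w3%:R ^+ (k + l))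
  = sum_triples n (fun k l m =>
    (trinomial n k l m)%:R
    * E (q ^+ (w1 * w3)) k (w2%:R * y)
    * T l (q ^+ (w1 * w2)) (w3 - 1)%N
    * T m (q ^+ (w2 * w3)) (w1 - 1)%N
    * w2%:R ^+ (l + m) * w3%:R ^+ (k + m) * w1%:R ^+ (k + l))
  /\
  sum_triples n (fun k l m =>
    (trinomial n k l m)%:R
    * E (q ^+ (w1 * w3)) k (w2%:R * y)
    * T l (q ^+ (w1 * w2)) (w3 - 1)%N
    * T m (q ^+ (w2 * w3)) (w1 - 1)%N
    * w2%:R ^+ (l + m) * w3%:R ^+ (k + m) * w1%:R ^+ (k + l))
  = sum_triples n (fun k l m =>
    (trinomial n k l m)%:R
    * E (q ^+ (w1 * w2)) k (w3%:R * y)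
    * T l (q ^+ (w2 * w3)) (w1 - 1)%N
    * T m (q ^+ (w1 * w3)) (w2 - 1)%N
    * w3%:R ^+ (l + m) * w1%:R ^+ (k + m) * w2%:R ^+ (k + l)).
Proof.
move=> E T y.
have p_gt1 : 1 < p%:R :> R by rewrite ltr1n prime_gt1.
(* The exponent -1/(p-1) is at most 0 and p > 1, so the radius is at most p^0 = 1. *)
have q1 : abs_Cp (q - 1) < 1.
  apply: (lt_le_trans hq); rewrite -[leRHS](powRr0 p%:R) ler_powR ?(ltW p_gt1) //.
  by rewrite oppr_le0 invr_ge0 subr_ge0 ltW.
have q_neq0 w : odd w -> q ^+ w + 1 != 0.
  by move=> _; exact: principal_unit_exp_add1_neq0.
have cycle := euler_power_sum_cycle _ (Cp_natr_neq0 R p C) q y n.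
(* The shift from (w1, w2, w3) gives the first equality, the one from (w2, w3, w1) the second. *)
have := cycle w1 w2 w3 q_neq0 hw1 hw2 hw3.
have := cycle w2 w3 w1 q_neq0 hw2 hw3 hw1.
rewrite /euler_power_sum (mulnC w2 w1) (mulnC w3 w1) (mulnC w3 w2).
by split.
Qed.
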